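(* Let $K\ge 1$ and let $M,N,d$ be positive integers such that $M$ and $N$ are both divisible by $d$. Consider the symmetric $K$-user MIMO interference channel with $M_k=M$ and $N_k=N$ for all $k$. Then the tuple $(d_1,\dots,d_K)=(d,\dots,d)$ is achievable through linear interference alignment for generic channel matrices if and only if $$M+N\ \ge\ d(K+1).$$
   Context: Setting: a $K$-user flat fading MIMO interference channel in which every transmitter has $M$ antennas and every receiver has $N$ antennas. The channel from transmitter $j$ to receiver $k$ is a complex matrix $\mathbf{H}_{kj}$ of size $N\times M$. Achievability through linear interference alignment: for given channel matrices $(\mathbf{H}_{kj})_{k,j=1}^K$, a tuple $(d_1,\dots,d_K)$ of nonnegative integers is achievable through linear interference alignment (without channel extension) if there exist matrices $\mathbf{V}_k\in\mathbb{C}^{M\times d_k}$ and $\mathbf{U}_k\in\mathbb{C}^{N\times d_k}$, $k=1,\dots,K$, such that $$\mathbf{U}_k^H\mathbf{H}_{kj}\mathbf{V}_j=\mathbf{0}\ \text{ for all } j\neq k,\qquad \operatorname{rank}(\mathbf{U}_k^H\mathbf{H}_{kk}\mathbf{V}_k)=d_k\ \text{ for all } k,$$ where $(\cdot)^H$ is the conjugate transpose. Generic: a property holds for generic channel matrices if it holds for all $(\mathbf{H}_{kj})_{k,j}$ in some nonempty Zariski open subset of $\prod_{k,j=1}^K\mathbb{C}^{N\times M}$. *)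

(* Defs.v *)
From mathcomp Require Import all_boot all_order all_algebra.
From mathcomp Require Export complex mpoly.
From mathcomp Require Export reals.

Set Implicit Arguments.
Unset Strict Implicit.
Unset Printing Implicit Defensive.

Import GRing.Theory Num.Theory.
Local Open Scope ring_scope.
Local Open Scope sesquilinear_scope.

Section InterferenceChannel.
Variables (C : numClosedFieldType) (K M N : nat).

(* [H k j] is the channel from transmitter [j] to receiver [k]. *)
Definition channels := 'I_K -> 'I_K -> 'M[C]_(N, M).

(* [^t*] is the conjugate transpose. *)
Definition achievable (H : channels) (ds : 'I_K -> nat) : Prop :=
  exists (V : forall k, 'M[C]_(M, ds k)) (U : forall k, 'M[C]_(N, ds k)),
    (forall k j, j != k -> (U k)^t* *m H k j *m V j = 0) /\
    (forall k, \rank ((U k)^t* *m H k k *m V k) = ds k).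

(* The affine space of all channels has one coordinate for each entry
   (k, j, a, b), namely [H k j a b]; the finite type of these indices is
   enumerated in order to match the variables of [{mpoly C[n]}]. *)
Definition entry : Type := 'I_K * 'I_K * 'I_N * 'I_M.

Definition coords (H : channels) (i : 'I_#|{: entry}|) : C :=
  let: (k, j, a, b) := enum_val i in H k j a b.

(* The complement of [O] is the common zero locus of the polynomials in [S];
   [S] may be infinite. *)
Definition zariski_open (O : channels -> Prop) : Prop :=
  exists S : {mpoly C[#|{: entry}|]} -> Prop,
    forall H, ~ O H <-> (forall p, S p -> p.@[coords H] = 0).

Definition generically (P : channels -> Prop) : Prop :=
  exists O : channels -> Prop,
    [/\ zariski_open O, exists H, O H & forall H, O H -> P H].

End InterferenceChannel.

(* Main.v *)
Require Import Defs.
From mathcomp Require Import all_boot all_order all_algebra.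
From mathcomp Require Import closed_field boolp zify ring.

Set Implicit Arguments.
Unset Strict Implicit.
Unset Printing Implicit Defensive.

Import GRing.Theory Num.Theory.
Local Open Scope ring_scope.
Local Open Scope sesquilinear_scope.

(**
After multiplying the [V k] by invertible matrices, alignment means
[W k *m H k j *m V j = (k == j)%:M] with [W k] the conjugate transpose of [U k].

Necessity. Some [d] rows of [V k] and [d] columns of [W k] are independent; make
these blocks the identity. Then each of the [K (K - 1) d^2] off-diagonal equations
expresses one entry of a channel polynomially in the remaining entries and in the
[K d (M - d) + K d (N - d)] free entries of [V] and [W]. If [M + N < d (K + 1)],
the achievable channels are thus covered by finitely many images of polynomial
maps with fewer variables than there are channel entries. The components of such a
map are algebraically dependent, so a nonzero polynomial vanishes on all
achievable channels.

Sufficiency. By quantifier elimination over an algebraically closed field, the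
achievable channels either contain a nonempty open set or are contained in the
zero locus of a nonzero polynomial, so it suffices that they are Zariski dense. Let
[X j] and [Y k] be square zero matrices whose only nonzero blocks are the lower
left one, with [d] columns, and the upper right one, with [d] rows. The channels
[(1 - s Y k) (H0 k j + s W1 k j) (1 - s X j)] are aligned for almost all [s] if the
upper left [d] by [d] corners of [H0 k j] and [W1 k j] vanish for [k <> j], and that
of [H0 k k] is the identity. Their tangent at [s = 0] is
[W1 k j - Y k *m H0 k j - H0 k j *m X j]. If [M = (p + 1) d], [N = (q + 1) d] and
[K - 1 <= p + q], then [H0] can be chosen so that every direction arises in this
way, and a polynomial that vanishes along curves through [H0] in all directions
is zero.
*)

(** * Polynomial functions *)

(** In characteristic zero the naturals below [size p] are distinct roots, one more than the degree
    allows. *)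
Lemma poly_fun_eq0 (F : numFieldType) (p : {poly F}) :
  (forall x, p.[x] = 0) -> p = 0.
Proof.
move=> p0; apply/eqP/negPn/negP => pn0.
pose rs := [seq i%:R : F | i <- iota 0 (size p)].
have urs : uniq rs.
  by rewrite map_inj_uniq ?iota_uniq // => i j /eqP; rewrite eqr_nat => /eqP.
have /(max_poly_roots pn0)/(_ urs) : all (root p) rs.
  by apply/allP => x _; apply/rootP.
by rewrite size_map size_iota ltnn.
Qed.

Lemma base_expansion_inj (L n : nat) (f g : nat -> nat) :
  (forall i, (f i < L)%N) -> (forall i, (g i < L)%N) ->
  (\sum_(i < n) f i * L ^ i = \sum_(i < n) g i * L ^ i)%N ->
  forall i, (i < n)%N -> f i = g i.
Proof.
elim: n f g => [//|n IHn] f g fL gL.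
rewrite !big_ord_recl !expn0 !muln1.
have L0 : (0 < L)%N by apply: leq_ltn_trans (fL 0%N).
have shift (h : nat -> nat) : (\sum_(i < n) h (lift ord0 i) * L ^ lift ord0 i =
    (\sum_(i < n) h i.+1 * L ^ i) * L)%N.
  by rewrite big_distrl; apply: eq_bigr => i _; rewrite lift0 expnSr mulnA.
rewrite !shift => E.
have E0 : f 0%N = g 0%N.
  have := congr1 (modn^~ L) E.
  by rewrite /= ![(_ 0%N + _)%N]addnC !modnMDl !modn_small.
move: E; rewrite E0 => /addnI/eqP; rewrite eqn_pmul2r // => /eqP E.
case=> [|i] lt_in //.
exact: (IHn (fun i => f i.+1) (fun i => g i.+1)).
Qed.

(* Kronecker substitution: evaluating at the powers x^(L^i), with L larger than
   all exponents, separates the monomials. *)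
Lemma mpoly_fun_eq0 (F : numFieldType) n (p : {mpoly F[n]}) :
  (forall v, p.@[v] = 0) -> p = 0.
Proof.
move=> p0; pose L := (msize p).+1.
pose wt (m : 'X_{1..n}) := (\sum_(i < n) m i * L ^ i)%N.
have wt_inj : {in msupp p &, injective wt}.
  have lt_mL m : m \in msupp p -> forall i : 'I_n, (m i < L)%N.
    move=> /msize_mdeg_lt /ltnW; rewrite /L mdegE => le_m i.
    by rewrite ltnS; apply: leq_trans le_m; rewrite (bigD1 i) //= leq_addr.
  move=> m1 m2 /lt_mL b1 /lt_mL b2 E; apply/mnmP => i.
  (* Multinomials are extended by 0 to digit sequences on all of [nat]. *)
  pose nat_of (m : 'X_{1..n}) k := if insub k is Some i then m i else 0%N.
  have nat_ofE m (j : 'I_n) : nat_of m j = m j by rewrite /nat_of valK.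
  have nat_of_lt (m : 'X_{1..n}) : (forall i : 'I_n, (m i < L)%N) ->
      forall k, (nat_of m k < L)%N.
    by move=> b k; rewrite /nat_of; case: insub.
  rewrite -!nat_ofE; apply: (@base_expansion_inj L n) => //; do ?exact: nat_of_lt.
  have wtE (m : 'X_{1..n}) : (\sum_(j < n) nat_of m j * L ^ j)%N = wt m.
    by apply: eq_bigr => j _; rewrite nat_ofE.
  by rewrite !wtE.
pose P : {poly F} := \sum_(m <- msupp p) p@_m *: 'X^(wt m).
have P0 : P = 0.
  apply: poly_fun_eq0 => x; rewrite /P horner_sum -[RHS](p0 (fun i => x ^+ (L ^ i)%N)).
  rewrite mevalE; apply: eq_bigr => m _; rewrite hornerZ hornerXn; congr (_ * _).
  rewrite /wt -prodrXr; apply: eq_bigr => i _.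
  by rewrite -exprM mulnC.
apply/mpolyP => m; rewrite mcoeff0.
have [mp|/memN_msupp_eq0 //] := boolP (m \in msupp p).
have := congr1 (fun q : {poly F} => q`_(wt m)) P0.
rewrite /P coef_sum coef0 (bigD1_seq m) ?msupp_uniq //= coefZ coefXn eqxx mulr1.
rewrite big_seq_cond big1 ?addr0 // => m' /andP[m'p ne].
rewrite coefZ coefXn; case: eqP => [E|_]; last by rewrite mulr0.
by rewrite (wt_inj m m') ?eqxx // in ne.
Qed.

(* The lowest homogeneous part of f at c vanishes at every direction w. *)
Lemma dense_of_curves (F : numFieldType) n (f : {mpoly F[n]}) (c : 'I_n -> F) :
  (forall w : 'I_n -> F, exists r : 'I_n -> {poly F},
     exists2 q : {poly F}, q != 0 &
       forall s, q.[s] != 0 ->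
         f.@[fun i => c i + s * w i + s ^+ 2 * (r i).[s]] = 0) ->
  f = 0.
Proof.
move=> Hc.
(* Translation moves the base point [c] to the origin. *)
pose g := f \mPo [tuple 'X_i + (c i)%:MP | i < n].
have gE v : g.@[v] = f.@[fun i => v i + c i].
  rewrite comp_mpoly_meval; apply: meval_eq => i.
  by rewrite tnth_mktuple mevalD mevalXU mevalC.
suff g0 : g = 0.
  apply: mpoly_fun_eq0 => v.
  have := gE (fun i => v i - c i); rewrite g0 meval0 => ->.
  by apply: meval_eq => i; rewrite subrK.
apply/eqP/negPn/negP => gn0.
have [m0 m0g] : exists m0, m0 \in msupp g.
  by exists (mlead g); exact: mlead_supp.
have exe : exists e, has (fun m => mdeg m == e) (msupp g).
  by exists (mdeg m0); apply/hasP; exists m0.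
case: (ex_minnP exe) => e /hasP[m1 m1g /eqP m1e] emin.
have le_e m : m \in msupp g -> (e <= mdeg m)%N.
  by move=> mg; apply: emin; apply/hasP; exists m.
pose h : {mpoly F[n]} := \sum_(m <- msupp g | mdeg m == e) g@_m *: 'X_[m].
suff h0 : h = 0.
  have := congr1 (mcoeff m1) h0.
  rewrite /h raddf_sum /= mcoeff0 big_mkcond (bigD1_seq m1) ?msupp_uniq ?m1e //= eqxx.
  rewrite mcoeffZ mcoeffX eqxx mulr1 big1 ?addr0 => [|m ne].
    by move/eqP; rewrite mcoeff_eq0 m1g.
  case: ifP => // _.
  by rewrite mcoeffZ mcoeffX (negPf ne) mulr0.
apply: mpoly_fun_eq0 => w.
have [r [q qn0 Hs]] := Hc w.
(* The curve is c + s y(s). [G] is g(s y(s)) divided by s^e; at s = 0 only the monomials of least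
   degree [e] survive, so G(0) = h(w). *)
pose y i : {poly F} := (w i)%:P + 'X * r i.
pose G : {poly F} :=
  \sum_(m <- msupp g) g@_m *: ('X^(mdeg m - e) * \prod_i y i ^+ m i).
have G0 : G = 0.
  have : 'X^e * q * G = 0.
    apply: poly_fun_eq0 => s; rewrite !hornerM hornerXn.
    have [->|/Hs fs0] := eqVneq q.[s] 0; first by rewrite mulr0 mul0r.
    suff -> : s ^+ e * q.[s] * G.[s] = q.[s] * g.@[fun i => s * (y i).[s]].
      rewrite gE; have -> := @meval_eq _ _ _ (fun i => c i + s * w i + s ^+ 2 * (r i).[s]) f _.
        by rewrite fs0 mulr0.
      move=> i; rewrite /y hornerD hornerC hornerM hornerX mulrDr mulrA -expr2.
      by rewrite addrC addrA.
    rewrite -mulrA mulrCA; congr (_ * _); rewrite mevalE /G horner_sum mulr_sumr.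
    apply: eq_big_seq => m mg; rewrite hornerZ hornerM hornerXn horner_prod.
    rewrite mulrCA mulrA; rewrite -mulrA [s ^+ e * _]mulrA -exprD subnKC ?le_e //.
    congr (_ * _); rewrite mdegE -prodrXr -big_split /=; apply: eq_bigr => i _.
    by rewrite exprMn horner_exp.
  by move/eqP; rewrite !mulf_eq0 expf_eq0 polyX_eq0 andbF (negPf qn0) => /eqP.
have := congr1 (fun P : {poly F} => P.[0]) G0.
rewrite /= horner0 => <-.
rewrite /h raddf_sum /= /G horner_sum big_mkcond /=; apply: eq_big_seq => m mg.
rewrite mevalZ hornerZ hornerM hornerXn mevalX horner_prod.
case: eqP => [->|ne]; rewrite ?subnn ?expr0 ?mul1r.
  congr (_ * _); apply: eq_bigr => i _.
  by rewrite horner_exp /y hornerD hornerC hornerM hornerX mul0r addr0.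
have : (0 < mdeg m - e)%N by move/le_e: mg; lia.
by case: (mdeg m - e)%N => // k _; rewrite expr0n mul0r mulr0.
Qed.

Lemma msize_exp_le (F : fieldType) n (p : {mpoly F[n]}) k :
  (msize (p ^+ k) <= k * (msize p + 1) + 1)%N.
Proof.
elim: k => [|k IHk]; first by rewrite expr0 msize1.
rewrite exprS; apply: leq_trans (msizeM_le _ _) _; lia.
Qed.

Lemma msize_prod_le (F : fieldType) n (I : finType) (q : I -> {mpoly F[n]}) b :
  (forall i, (msize (q i) <= b)%N) -> (msize (\prod_i q i) <= #|I| * (b + 1) + 1)%N.
Proof.
move=> qb; rewrite cardE -[X in msize X]big_enum /=.
elim: (enum I) => [|i s IHs]; first by rewrite big_nil msize1.
rewrite big_cons /=; apply: leq_trans (msizeM_le _ _) _.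
have := qb i; lia.
Qed.

(* For large D, substituting phi maps the D ^ m monomials with all exponents
   below D into a space of dimension at most L ^ n < D ^ m. *)
Lemma algebraic_dependence (F : fieldType) n m (phi : 'I_m -> {mpoly F[n]}) :
  (n < m)%N ->
  exists2 f : {mpoly F[m]}, f != 0 & forall v, f.@[fun i => (phi i).@[v]] = 0.
Proof.
move=> lt_nm.
pose e := (\max_i msize (phi i))%N.
(* [G] is large enough for every [psi a] to have size at most D G = L, and D > G^n gives L^n = D^n
   G^n < D^(n+1). *)
pose G := (m * (e + 3) + 1)%N; pose D := (G ^ n + 1)%N; pose L := (D * G)%N.
have lt_card : (L ^ n < D ^ m)%N.
  rewrite expnMn mulnC; apply: (@leq_trans (D ^ n.+1)); last first.
    by apply: leq_pexp2l => //; rewrite /D addn1.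
  by rewrite expnS ltn_pmul2r ?expn_gt0 ?/D ?addn1.
pose A := {ffun 'I_m -> 'I_D}; pose B := {ffun 'I_n -> 'I_L}.
pose ma (a : A) : 'X_{1..m} := [multinom (a i : nat) | i < m].
pose mb (b : B) : 'X_{1..n} := [multinom (b i : nat) | i < n].
have ma_inj : injective ma.
  move=> a1 a2 E; apply/ffunP => i; apply: val_inj.
  by move/mnmP: E => /(_ i); rewrite !mnmE.
pose psi (a : A) := \prod_i phi i ^+ a i.
have psi_size a : (msize (psi a) <= L)%N.
  apply: leq_trans (@msize_prod_le _ _ _ _ (D * (e + 1) + 1) _) _.
    move=> i; apply: leq_trans (msize_exp_le _ _) _.
    have : (msize (phi i) <= e)%N by exact: leq_bigmax.
    have := ltn_ord (a i); nia.
  have : (0 < D)%N by rewrite /D addn1.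
  rewrite card_ord /L /G; nia.
have psi_eq0 (q : {mpoly F[n]}) :
    (msize q <= L)%N -> (forall b, q@_(mb b) = 0) -> q = 0.
  move=> qL q0; apply/mpolyP => k; rewrite mcoeff0.
  have [kq|/memN_msupp_eq0 //] := boolP (k \in msupp q).
  have k_lt i : (k i < L)%N.
    have := leq_trans (msize_mdeg_lt kq) qL; apply: leq_ltn_trans.
    by rewrite mdegE (bigD1 i) //= leq_addr.
  rewrite -[RHS](q0 [ffun i => Ordinal (k_lt i)]); congr (q@__).
  by apply/mnmP => i; rewrite mnmE ffunE.
pose X : 'M[F]_(#|{: A}|, #|{: B}|) :=
  \matrix_(i, j) (psi (enum_val i))@_(mb (enum_val j)).
(* [X] has more rows than columns, so the [psi a] satisfy a nontrivial linear relation [u]. *)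
have /rowV0Pn[u /sub_kermxP uX un0] : kermx X != 0.
  rewrite -mxrank_eq0 mxrank_ker -lt0n subn_gt0.
  by apply: leq_ltn_trans (rank_leq_col _) _; rewrite !card_ffun !card_ord.
exists (\sum_i u 0 i *: 'X_[ma (enum_val i)]).
  apply: contraNneq un0 => f0; apply/eqP/rowP => i; rewrite mxE.
  have := congr1 (mcoeff (ma (enum_val i))) f0.
  rewrite raddf_sum /= mcoeff0 (bigD1 i) //= mcoeffZ mcoeffX eqxx mulr1.
  rewrite big1 ?addr0 // => j ne; rewrite mcoeffZ mcoeffX.
  case: eqP => [/ma_inj/enum_val_inj E|_]; last by rewrite mulr0.
  by rewrite E eqxx in ne.
have q0 : \sum_i u 0 i *: psi (enum_val i) = 0.
  apply: psi_eq0 => [|b].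
    apply: (big_ind (fun q => msize q <= L)%N) => [|p q pL qL|i _].
    - by rewrite msize0.
    - by apply: leq_trans (msizeD_le _ _) _; rewrite geq_max pL.
    - by apply: leq_trans (msizeZ_le _ _) _.
  rewrite raddf_sum; have := congr1 (fun Y : 'rV_#|{: B}| => Y 0 (enum_rank b)) uX.
  rewrite mxE [RHS]mxE => E; rewrite -[RHS]E; apply: eq_bigr => i _.
  by rewrite /= mxE enum_rankK mcoeffZ.
move=> v; rewrite -[RHS](meval0 v) -q0 !rmorph_sum /=; apply: eq_bigr => i _.
rewrite !mevalZ mevalX rmorph_prod; congr (_ * _); apply: eq_bigr => j _.
by rewrite mnmE rmorphXn.
Qed.

(** * Definable sets over a closed field *)

Definition env (F : fieldType) n (v : 'I_n -> F) : seq F := codom v.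

Lemma nth_env (F : fieldType) n (v : 'I_n -> F) (i : 'I_n) : (env v)`_i = v i.
Proof. by rewrite /env codomE (nth_map i) ?size_enum_ord // nth_ord_enum. Qed.

Lemma rterm_mpoly (F : fieldType) n (t : GRing.term F) : GRing.rterm t ->
  exists p : {mpoly F[n]}, forall v, p.@[v] = GRing.eval (env v) t.
Proof.
elim: t => //=.
- move=> i _; case: (ltnP i n) => [lt_in|le_ni].
    exists 'X_(Ordinal lt_in) => v.
    by rewrite mevalXU -(nth_env v (Ordinal lt_in)).
  (* Variables beyond the environment read the default value 0. *)
  exists 0 => v; rewrite meval0 nth_default //.
  by rewrite /env size_codom card_ord.
- by move=> c _; exists c%:MP => v; rewrite mevalC.
- by move=> k _; exists k%:R => v; rewrite rmorph_nat.
- move=> t1 IH1 t2 IH2 /andP[/IH1[p1 E1] /IH2[p2 E2]].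
  by exists (p1 + p2) => v; rewrite mevalD E1 E2.
- by move=> t IH /IH[p E]; exists (- p) => v; rewrite mevalN E.
- by move=> t IH k /IH[p E]; exists (p *+ k) => v; rewrite mevalMn E.
- move=> t1 IH1 t2 IH2 /andP[/IH1[p1 E1] /IH2[p2 E2]].
  by exists (p1 * p2) => v; rewrite mevalM E1 E2.
- by move=> t IH k /IH[p E]; exists (p ^+ k) => v; rewrite rmorphXn /= E.
Qed.

(** Off a hypersurface each atom has a constant truth value: an equation holds identically or fails
    wherever the difference of its sides is nonzero. Connectives multiply the polynomials. *)
Lemma qf_generic_dichotomy (F : fieldType) n (f : GRing.formula F) :
  GRing.qf_form f -> GRing.rformula f ->
  exists2 p : {mpoly F[n]}, p != 0 &
    (forall v, p.@[v] != 0 -> GRing.holds (env v) f) \/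
    (forall v, p.@[v] != 0 -> ~ GRing.holds (env v) f).
Proof.
have n10 : (1 : {mpoly F[n]}) != 0 by exact: oner_neq0.
have comb (p q : {mpoly F[n]}) : p != 0 -> q != 0 -> p * q != 0 /\
    forall v, (p * q).@[v] != 0 -> p.@[v] != 0 /\ q.@[v] != 0.
  move=> pn0 qn0; split=> [|v]; first by rewrite mulf_neq0.
  by rewrite mevalM mulf_eq0 negb_or => /andP.
elim: f => //=.
- by case=> _ _; exists 1 => //; [left | right].
- move=> t1 t2 _ /andP[/rterm_mpoly E1 /rterm_mpoly E2].
  have [[p1 {}E1] [p2 {}E2]] := (E1 n, E2 n).
  have [E|] := eqVneq (p1 - p2) 0.
    exists 1 => //; left=> v _; rewrite -E1 -E2.
    by apply/eqP; rewrite -subr_eq0 -mevalB E meval0.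
  exists (p1 - p2) => //; right=> v; rewrite mevalB E1 E2 => /eqP ne Eq.
  by apply: ne; rewrite Eq subrr.
- move=> f1 IH1 f2 IH2 /andP[q1 q2] /andP[r1 r2].
  have [p1 p1n H1] := IH1 q1 r1; have [p2 p2n H2] := IH2 q2 r2.
  have [pn Hp] := comb _ _ p1n p2n; exists (p1 * p2) => //.
  case: H1 => H1; last by right=> v /Hp[/H1 h _] [].
  case: H2 => H2; last by right=> v /Hp[_ /H2 h] [].
  by left=> v /Hp[/H1 h1 /H2 h2].
- move=> f1 IH1 f2 IH2 /andP[q1 q2] /andP[r1 r2].
  have [p1 p1n H1] := IH1 q1 r1; have [p2 p2n H2] := IH2 q2 r2.
  have [pn Hp] := comb _ _ p1n p2n; exists (p1 * p2) => //.
  case: H1 => H1; first by left=> v /Hp[/H1 h _]; left.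
  case: H2 => H2; first by left=> v /Hp[_ /H2 h]; right.
  by right=> v /Hp[/H1 h1 /H2 h2] [].
- move=> f1 IH1 f2 IH2 /andP[q1 q2] /andP[r1 r2].
  have [p1 p1n H1] := IH1 q1 r1; have [p2 p2n H2] := IH2 q2 r2.
  have [pn Hp] := comb _ _ p1n p2n; exists (p1 * p2) => //.
  case: H1 => H1; last by left=> v /Hp[/H1 h _] /h.
  case: H2 => H2; first by left=> v /Hp[_ /H2 h] _.
  by right=> v /Hp[/H1 h1 /H2 h2] h; apply: h2; apply: h.
- move=> f IH q r; have [p pn H] := IH q r; exists p => //.
  case: H => H; [right | left] => v /H // h; exact.
Qed.

(* Quantifier elimination plays the role of Chevalley's theorem. *)
Lemma definable_dense_generic (F : closedFieldType) n (f : GRing.formula F) :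
  (forall p : {mpoly F[n]},
     (forall v, GRing.holds (env v) f -> p.@[v] = 0) -> p = 0) ->
  exists2 p : {mpoly F[n]}, p != 0 &
    forall v, p.@[v] != 0 -> GRing.holds (env v) f.
Proof.
move=> dense.
have wf := @ClosedFieldQE.wf_ex_elim F.
have ok := ClosedFieldQE.holds_ex_elim (@GRing.solve_monicpoly F).
set proj := @ClosedFieldQE.ex_elim F in wf ok.
pose g := GRing.quantifier_elim proj (GRing.to_rform f).
have /andP[gq gr] : GRing.qf_form g && GRing.rformula g.
  exact: (GRing.quantifier_elim_wf wf (GRing.to_rform_rformula f)).
have gP e : GRing.holds e g <-> GRing.holds e f.
  apply: iff_trans (GRing.to_rformP e f); split.
    move=> h; have := introT (GRing.qf_evalP e gq) h.
    by move/(GRing.quantifier_elim_rformP wf ok _ (GRing.to_rform_rformula f)).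
  move=> h; apply: (elimT (GRing.qf_evalP e gq)).
  exact/(GRing.quantifier_elim_rformP wf ok _ (GRing.to_rform_rformula f)).
have [p pn0 [H|H]] := @qf_generic_dichotomy F n g gq gr.
  by exists p => // v /H /gP.
(* If [g] failed generically, [p] would vanish wherever [f] holds, against density. *)
have p0 : p = 0.
  apply: dense => v /gP hv; apply/eqP/negPn/negP => /H; exact.
by rewrite p0 eqxx in pn0.
Qed.

(** * Alignment as a first-order formula *)

Lemma mpoly_nonzero_point (F : numFieldType) n (p : {mpoly F[n]}) :
  p != 0 -> exists v, p.@[v] != 0.
Proof.
move=> pn0; apply: contrapT => h; case/eqP: pn0; apply: mpoly_fun_eq0 => v.
by apply: contrapT => /eqP pv; apply: h; exists v.
Qed.

Section Alignment.
Variables (C : numClosedFieldType) (K M N d : nat).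
Notation channels := (channels C K M N).
Notation n := #|{: entry K M N}|.
Implicit Type H : channels.

Definition aligned H (W : 'I_K -> 'M[C]_(d, N)) (V : 'I_K -> 'M[C]_(M, d)) :=
  forall k j, W k *m H k j *m V j = if k == j then 1%:M else 0.

Lemma achievableP H :
  achievable H (fun _ => d) <-> exists W V, aligned H W V.
Proof.
split=> [[V [U [UHV0 rkUHV]]]|[W [V WHV]]].
  pose G k := (U k)^t* *m H k k *m V k.
  have Gu k : G k \in unitmx by rewrite -row_full_unit; apply/eqP; exact: rkUHV.
  exists (fun k => (U k)^t*), (fun j => V j *m invmx (G j)) => k j.
  rewrite mulmxA; case: eqP => [<-|/eqP ne]; first exact: (mulmxV (Gu k)).
  by rewrite UHV0 ?mul0mx // eq_sym.
exists V, (fun k => (W k)^t*); split=> [k j ne|k]; rewrite trmxCK WHV.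
  by rewrite eq_sym (negPf ne).
by rewrite eqxx mxrank1.
Qed.

Definition channels_of (v : 'I_n -> C) : channels :=
  fun k j => \matrix_(a, b) v (enum_rank ((k, j, a, b) : entry K M N)).

Lemma coords_rank H k j a b :
  coords H (enum_rank ((k, j, a, b) : entry K M N)) = H k j a b.
Proof. by rewrite /coords enum_rankK. Qed.

Lemma channels_ofK v : coords (channels_of v) =1 v.
Proof.
move=> i; rewrite -(enum_valK i); case: (enum_val i) => [[[k j] a] b].
by rewrite coords_rank mxE.
Qed.

Definition unknown : Type := ('I_K * 'I_d * 'I_N) + ('I_K * 'I_M * 'I_d).

(** Variables below [n] are the channel entries in the order of [coords]; the unknowns, to be
    quantified, are numbered from [n] on. *)
Let Ht k j : 'M[GRing.term C]_(N, M) :=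
  \matrix_(a, b) GRing.Var C (enum_rank ((k, j, a, b) : entry K M N)).
Let Wt k : 'M[GRing.term C]_(d, N) :=
  \matrix_(a, r) GRing.Var C (n + enum_rank (inl (k, a, r) : unknown)).
Let Vt k : 'M[GRing.term C]_(M, d) :=
  \matrix_(r, b) GRing.Var C (n + enum_rank (inr (k, r, b) : unknown)).

Let big_and (I : finType) (f : I -> GRing.formula C) :=
  \big[GRing.And/GRing.Bool true]_i f i.

Lemma holds_big_and (I : finType) e (f : I -> GRing.formula C) :
  GRing.holds e (big_and f) <-> forall i, GRing.holds e (f i).
Proof.
rewrite /big_and; have mem_all i : i \in index_enum I by exact: mem_index_enum.
transitivity (forall i, i \in index_enum I -> GRing.holds e (f i)); last first.
  by split=> h i; [apply: h | move=> _].
elim: (index_enum I) => [|i s IHs]; first by rewrite big_nil.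
rewrite big_cons /=; split=> [[fi /IHs h] j|h].
  by rewrite inE => /predU1P[->|/h].
split; first by apply: h; rewrite mem_head.
by apply/IHs => j js; apply: h; rewrite inE js orbT.
Qed.

Definition aligned_form : GRing.formula C :=
  big_and (fun k => big_and (fun j => big_and (fun a => big_and (fun b =>
    GRing.Equal
      (MatrixFormula.mulmx_term
         (MatrixFormula.mulmx_term (Wt k) (Ht k j)) (Vt j) a b)
      (GRing.Const ((if k == j then 1%:M else 0 : 'M_d) a b)))))).

Lemma holds_aligned_form e H W V :
  (forall k j, MatrixFormula.eval_mx e (Ht k j) = H k j) ->
  (forall k, MatrixFormula.eval_mx e (Wt k) = W k) ->
  (forall k, MatrixFormula.eval_mx e (Vt k) = V k) ->
  GRing.holds e aligned_form <-> aligned H W V.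
Proof.
move=> EH EW EV.
have E k j a b : GRing.eval e (MatrixFormula.mulmx_term
         (MatrixFormula.mulmx_term (Wt k) (Ht k j)) (Vt j) a b) =
    (W k *m H k j *m V j) a b.
  by rewrite -EH -EW -EV -!MatrixFormula.eval_mulmx [RHS]mxE.
split.
  move/holds_big_and=> h k j; apply/matrixP => a b.
  move/holds_big_and: (h k) => /(_ j)/holds_big_and/(_ a)/holds_big_and/(_ b) /=.
  by rewrite E.
move=> al; apply/holds_big_and => k; apply/holds_big_and => j.
apply/holds_big_and => a; apply/holds_big_and => b /=.
by rewrite E al.
Qed.

Definition achievable_form : GRing.formula C :=
  foldr GRing.Exists aligned_form (iota n #|{: unknown}|).

Lemma holds_achievable_form H :
  GRing.holds (env (coords H)) achievable_form <-> achievable H (fun _ => d).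
Proof.
rewrite /achievable_form -GRing.foldExistsP; apply: iff_trans (iff_sym (achievableP H)).
have size_env : size (env (coords H)) = n by rewrite size_codom card_ord.
split=> [[e eq_e e_al]|[W [V al]]].
  pose W k : 'M_(d, N) := \matrix_(a, r) e`_(n + enum_rank (inl (k, a, r) : unknown)).
  pose V k : 'M_(M, d) := \matrix_(r, b) e`_(n + enum_rank (inr (k, r, b) : unknown)).
  exists W, V; apply: (proj1 (holds_aligned_form (e := e) _ _ _) e_al) => *.
  - apply/matrixP => a b; rewrite !mxE /= -eq_e ?nth_env ?coords_rank //.
    by rewrite !inE mem_iota leqNgt ltn_ord.
  - by apply/matrixP => a b; rewrite !mxE.
  - by apply/matrixP => a b; rewrite !mxE.
pose g (z : unknown) := match z with
  | inl (k, a, r) => W k a r | inr (k, r, b) => V k r b end.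
pose e := env (coords H) ++ codom g.
have eg z : e`_(n + enum_rank z) = g z.
  rewrite /e nth_cat size_env ltnNge leq_addr addKn.
  by rewrite nth_codom enum_rankK.
exists e.
  (* Outside the quantified indices both environments agree: they list the coordinates below [n] and
     read the default 0 past the unknowns. *)
  move=> i; rewrite !inE mem_iota negb_and -leqNgt -ltnNge /e => ie.
  rewrite nth_cat size_env; case: ltnP => // le_ni.
  rewrite [LHS]nth_default ?size_env // nth_default // size_codom.
  by move: ie; rewrite ltnNge le_ni /= leq_subRL // addnC.
apply: (proj2 (holds_aligned_form (e := e) _ _ _) al) => *.
- apply/matrixP => a b; rewrite !mxE /= /e nth_cat size_env ltn_ord.
  by rewrite nth_env coords_rank.
- by apply/matrixP => a b; rewrite !mxE /= eg.
- by apply/matrixP => a b; rewrite !mxE /= eg.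
Qed.

Lemma zariski_open_nonzero (p : {mpoly C[n]}) :
  zariski_open (fun H : channels => p.@[coords H] != 0).
Proof.
exists (eq p) => H; split=> [/negP|h]; first by rewrite negbK => /eqP p0 _ <-.
by rewrite h // eqxx.
Qed.

Lemma generically_dense :
  (forall p : {mpoly C[n]},
     (forall H, achievable H (fun _ => d) -> p.@[coords H] = 0) -> p = 0) ->
  generically (fun H => achievable H (fun _ => d)).
Proof.
move=> dense.
have [p pn0 Hp] : exists2 p : {mpoly C[n]}, p != 0 &
    forall v, p.@[v] != 0 -> GRing.holds (env v) achievable_form.
  apply: definable_dense_generic => p Hp; apply: dense => H.
  by move/holds_achievable_form/Hp.
exists (fun H => p.@[coords H] != 0); split.
- exact: zariski_open_nonzero.
- have [v /eqP pv] := mpoly_nonzero_point pn0.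
  by exists (channels_of v); rewrite (meval_eq _ (channels_ofK v)); apply/eqP.
- by move=> H pH; apply/holds_achievable_form/Hp.
Qed.

End Alignment.

(** * Sufficiency *)

(** The determinant is a polynomial in [s] with value 1 at 0, so it excludes only finitely many
    [s]. *)
Lemma det_line_poly (F : fieldType) d (A : 'M[F]_d) :
  exists2 q : {poly F}, q != 0 & forall s, q.[s] = \det (1%:M + s *: A).
Proof.
exists (\det (1%:M + 'X *: map_mx polyC A)) => [|s].
  apply/eqP => q0; have := congr1 (horner_eval 0) q0.
  rewrite rmorph0 -det_map_mx /= map_mxD map_mxZ /= map_mx1 /horner_eval hornerX.
  by rewrite scale0r addr0 det1 => /eqP; rewrite oner_eq0.
rewrite -[LHS]/(horner_eval s _) -det_map_mx map_mxD map_mxZ /= map_mx1.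
rewrite /horner_eval hornerX; congr (\det (_ + _ *: _)).
by apply/matrixP => i j; rewrite !mxE hornerC.
Qed.

Lemma unipotent_line_expansion (R : comNzRingType) N M (Y : 'M[R]_N) (X : 'M[R]_M)
    (A B : 'M[R]_(N, M)) s :
  (1%:M - s *: Y) *m (A + s *: B) *m (1%:M - s *: X) =
  A + s *: (B - Y *m A - A *m X)
    + s ^+ 2 *: (Y *m A *m X - Y *m B - B *m X + s *: (Y *m B *m X)).
Proof.
rewrite !(mulmxBl, mulmxBr, mulmxDl, mulmxDr) !mul1mx !mulmx1.
do !rewrite ?(mulNmx, mulmxN) -?scalemxAl -?scalemxAr.
move: (Y *m A *m X) (Y *m B *m X) (Y *m A) (A *m X) (Y *m B) (B *m X).
by move=> A1 A2 A3 A4 A5 A6; apply/matrixP => a b; rewrite !mxE; ring.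
Qed.

Section Sufficiency.
Variables (C : numClosedFieldType) (K' M' N' d p q : nat).
Notation K := K'.+1.
Notation M := M'.+1.
Notation N := N'.+1.
Hypotheses (d_gt0 : (0 < d)%N) (ME : M = (p.+1 * d)%N) (NE : N = (q.+1 * d)%N).
Hypothesis le_K : (K <= p + q + 1)%N.
Notation channels := (channels C K M N).

(** The difference k - j modulo [K]; adding [K] avoids truncated subtraction. *)
Let shift (k j : 'I_K) := ((k + K - j) %% K)%N.

Let shift_lt k j : (shift k j < K)%N. Proof. exact: ltn_pmod. Qed.

Let addn_shift (k j : 'I_K) : ((j + shift k j) %% K)%N = k.
Proof.
rewrite /shift modnDmr addnC subnK; last by have := ltn_ord j; lia.
by rewrite modnDr modn_small.
Qed.

Let subn_shift (k j : 'I_K) : ((k + K - shift k j) %% K)%N = j.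
Proof.
have [le_jk|lt_kj] := leqP j k.
  have -> : shift k j = (k - j)%N.
    rewrite /shift addnC -addnBA // modnDl modn_small //.
    by have := ltn_ord k; lia.
  have -> : (k + K - (k - j) = j + K)%N by have := ltn_ord k; lia.
  by rewrite modnDr modn_small.
have -> : shift k j = (k + K - j)%N.
  by rewrite /shift modn_small //; have := ltn_ord j; lia.
have -> : (k + K - (k + K - j) = j)%N by have := ltn_ord j; lia.
by rewrite modn_small.
Qed.

Let shift_eq0 (k j : 'I_K) : (shift k j == 0%N) = (k == j).
Proof.
apply/eqP/eqP => [E|->]; last by rewrite /shift addKn modnn.
by apply: val_inj; rewrite /= -(addn_shift k j) E addn0 modn_small.
Qed.

Let leM : (d <= M)%N. Proof. by rewrite ME leq_pmull. Qed.
Let leN : (d <= N)%N. Proof. by rewrite NE leq_pmull. Qed.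
Let iM (b : 'I_d) : 'I_M := widen_ord leM b.
Let iN (a : 'I_d) : 'I_N := widen_ord leN a.

(* For k <> j the shift k - j selects either one of the p blocks of unknowns of
   transmitter j or one of the q blocks of receiver k, each block only once. *)
Let H0 : channels := fun k j => \matrix_(r, c)
  (if (shift k j <= p)%N then (r < d)%N && (c == shift k j * d + r :> nat)%N
   else (c < d)%N && (r == (shift k j - p) * d + c :> nat)%N)%:R.

Section Direction.
Variable D : channels.

(* X and Y cancel the corners of D with k <> j to first order. *)
Let X (j : 'I_K) : 'M[C]_M := \matrix_(c, b)
  if (b < d)%N && (d <= c)%N
  then - D (inord ((j + c %/ d) %% K)) j (inord (c %% d)) b else 0.

Let Y (k : 'I_K) : 'M[C]_N := \matrix_(a, r)
  if (a < d)%N && (d <= r)%N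
  then - D k (inord ((k + K - (p + r %/ d)) %% K)) a (inord (r %% d)) else 0.

Let X2 j : X j *m X j = 0.
Proof.
apply/matrixP => c b; rewrite !mxE big1 // => l _; rewrite !mxE.
by case: (ltnP l d); rewrite ?andbF ?mul0r ?mulr0.
Qed.

Let Y2 k : Y k *m Y k = 0.
Proof.
apply/matrixP => c b; rewrite !mxE big1 // => l _; rewrite !mxE.
by case: (ltnP l d); rewrite ?andbF ?mul0r ?mulr0.
Qed.

(** Chosen so that the tangent of [line] at 0 is [D]. *)
Let W1 k j := D k j + Y k *m H0 k j + H0 k j *m X j.

Let H0_corner k j (a b : 'I_d) :
  H0 k j (iN a) (iM b) = if k == j then (a == b)%:R else 0.
Proof.
rewrite mxE /= !ltn_ord /= -shift_eq0.
case: (posnP (shift k j)) => [->|s0]; first by rewrite mul0n add0n eq_sym.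
have := ltn_ord a; have := ltn_ord b => ltb lta.
have [le_sp|lt_ps] := leqP.
  have -> : (b == shift k j * d + a :> nat)%N = false by nia.
  by [].
by have -> : (a == (shift k j - p) * d + b :> nat)%N = false by nia.
Qed.

(** For a shift s with 0 < s <= p, the identity block of [H0 k j] moves block s of [X j] into the
    corner of [H0 k j *m X j], where it cancels that of [D k j]; the corner of [Y k *m H0 k j] is
    zero. For s > p the roles are exchanged, with block s - p of [Y k]. *)
Let W1_corner k j (a b : 'I_d) : k != j -> W1 k j (iN a) (iM b) = 0.
Proof.
rewrite -shift_eq0 -lt0n => s0.
have := ltn_ord a; have := ltn_ord b => ltb lta.
have ltK := shift_lt k j.
have [le_sp|lt_ps] := leqP (shift k j) p.
  have lt_c : (shift k j * d + a < M)%N by rewrite ME; nia.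
  have YH : (Y k *m H0 k j) (iN a) (iM b) = 0.
    rewrite mxE big1 // => r _; rewrite [H0 _ _ _ _]mxE le_sp /=.
    have -> : (b == shift k j * d + r :> nat)%N = false by nia.
    by rewrite andbF mulr0.
  have HX : (H0 k j *m X j) (iN a) (iM b) = - D k j (iN a) (iM b).
    rewrite mxE (bigD1 (Ordinal lt_c)) //= big1 ?addr0 => [|c ne].
      rewrite [H0 _ _ _ _]mxE le_sp /= lta eqxx mul1r mxE /= ltb.
      have -> : (d <= shift k j * d + a)%N by nia.
      rewrite divnMDl // (divn_small lta) addn0 modnMDl (modn_small lta) addn_shift.
      by rewrite inord_val; congr (- D _ _ _ _); apply: val_inj; rewrite /= inordK //; lia.
    rewrite [H0 _ _ _ _]mxE le_sp /= lta /=.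
    have -> : (c == shift k j * d + a :> nat)%N = false by apply: negbTE; exact: ne.
    by rewrite mul0r.
  by rewrite /W1 mxE HX mxE YH addr0 subrr.
have lt_r : ((shift k j - p) * d + b < N)%N by rewrite NE; nia.
have HX : (H0 k j *m X j) (iN a) (iM b) = 0.
  rewrite mxE big1 // => c _; rewrite [H0 _ _ _ _]mxE leqNgt lt_ps /=.
  have -> : (a == (shift k j - p) * d + c :> nat)%N = false by nia.
  by rewrite andbF mul0r.
have YH : (Y k *m H0 k j) (iN a) (iM b) = - D k j (iN a) (iM b).
  rewrite mxE (bigD1 (Ordinal lt_r)) //= big1 ?addr0 => [|r ne].
    rewrite [H0 _ _ _ _]mxE leqNgt lt_ps /= ltb eqxx mulr1 mxE /= lta.
    have -> : (d <= (shift k j - p) * d + b)%N by nia.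
    rewrite divnMDl // (divn_small ltb) addn0 modnMDl (modn_small ltb).
    rewrite subnKC ?(ltnW lt_ps) // subn_shift inord_val.
    by congr (- D _ _ _ _); apply: val_inj; rewrite /= inordK //; lia.
  rewrite [H0 _ _ _ _]mxE leqNgt lt_ps /= ltb /=.
  have -> : (r == (shift k j - p) * d + b :> nat)%N = false by apply: negbTE; exact: ne.
  by rewrite mulr0.
by rewrite /W1 mxE HX mxE YH addr0 subrr.
Qed.

Let EN : 'M[C]_(d, N) := rowsub iN 1%:M.
Let EM : 'M[C]_(M, d) := colsub iM 1%:M.

Let cornerE (Z : 'M[C]_(N, M)) : EN *m Z *m EM = mxsub iN iM Z.
Proof. by rewrite /EN /EM mul_rowsub_mx mul1mx mulmx_colsub mulmx1 -mxsub_comp. Qed.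

Let line s : channels := fun k j =>
  (1%:M - s *: Y k) *m (H0 k j + s *: W1 k j) *m (1%:M - s *: X j).

(** As [X j] and [Y k] square to zero, the factors with plus signs undo those of [line]. What
    remains is the corner of [H0 k j + s *: W1 k j], which is zero off the diagonal and [G k] on
    it. *)
Let line_achievable s :
  (forall k, \det (1%:M + s *: mxsub iN iM (W1 k k)) != 0) ->
  achievable (line s) (fun _ => d).
Proof.
move=> dn0; apply/achievableP.
pose G k := 1%:M + s *: mxsub iN iM (W1 k k).
exists (fun k => EN *m (1%:M + s *: Y k)).
exists (fun j => (1%:M + s *: X j) *m EM *m invmx (G j)) => k j.
have inv n (Z : 'M[C]_n) : Z *m Z = 0 ->
    (1%:M + s *: Z) *m (1%:M - s *: Z) = 1%:M /\
    (1%:M - s *: Z) *m (1%:M + s *: Z) = 1%:M.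
  move=> Z0; have sZ0 : (s *: Z) *m (s *: Z) = 0.
    by rewrite -scalemxAl -scalemxAr Z0 !scaler0.
  rewrite mulmxDl mulmxBl !(mulmxBr, mulmxDr) !mul1mx !mulmx1 sZ0.
  by rewrite subr0 addr0 subrK addrK.
have [YI _] := inv _ _ (Y2 k); have [_ XI] := inv _ _ (X2 j).
have -> : EN *m (1%:M + s *: Y k) *m line s k j *m
    ((1%:M + s *: X j) *m EM *m invmx (G j)) =
    EN *m (H0 k j + s *: W1 k j) *m EM *m invmx (G j).
  rewrite /line !mulmxA -[EN *m _ *m (1%:M - _)]mulmxA YI mulmx1.
  by rewrite -[_ *m (1%:M - _) *m (1%:M + _)]mulmxA XI mulmx1.
rewrite cornerE linearD linearZ /=.
have -> : mxsub iN iM (H0 k j) = if k == j then 1%:M else 0.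
  by apply/matrixP => a b; rewrite mxE H0_corner; case: eqP; rewrite mxE.
have [<-|ne] := eqVneq k j.
  by rewrite mulmxV // unitmxE unitfE dn0.
suff -> : mxsub iN iM (W1 k j) = 0 by rewrite scaler0 addr0 mul0mx.
by apply/matrixP => a b; rewrite mxE W1_corner // mxE.
Qed.

Let lineE s k j : line s k j = H0 k j + s *: D k j
  + s ^+ 2 *: (Y k *m H0 k j *m X j - Y k *m W1 k j - W1 k j *m X j
               + s *: (Y k *m W1 k j *m X j)).
Proof.
rewrite /line unipotent_line_expansion; congr (_ + _ *: _ + _).
by rewrite /W1 addrAC addrK addrK.
Qed.

Lemma achievable_curve : exists R0 R1 : channels, exists2 q : {poly C}, q != 0 &
  forall s, q.[s] != 0 ->
    achievable (fun k j => H0 k j + s *: D k j + s ^+ 2 *: (R0 k j + s *: R1 k j))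
      (fun _ => d).
Proof.
exists (fun k j => Y k *m H0 k j *m X j - Y k *m W1 k j - W1 k j *m X j).
exists (fun k j => Y k *m W1 k j *m X j).
have /choice[r Hr] k : exists r : {poly C}, r != 0 /\
    forall s, r.[s] = \det (1%:M + s *: mxsub iN iM (W1 k k)).
  by have [r] := det_line_poly (mxsub iN iM (W1 k k)); exists r.
exists (\prod_k r k) => [|s].
  by apply/prodf_neq0 => k _; case: (Hr k).
rewrite horner_prod => /prodf_neq0 rs.
have /line_achievable : forall k, \det (1%:M + s *: mxsub iN iM (W1 k k)) != 0.
  by move=> k; case: (Hr k) => _ <-; apply: rs.
congr achievable; apply: funext => k; apply: funext => j.
exact: lineE.
Qed.

End Direction.

Lemma achievable_dense (f : {mpoly C[#|{: entry K M N}|]}) :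
  (forall H : channels, achievable H (fun _ => d) -> f.@[coords H] = 0) -> f = 0.
Proof.
move=> f0; apply: (dense_of_curves (c := coords H0)) => w.
have [R0 [R1 [r rn0 Hr]]] := achievable_curve (channels_of w).
exists (fun i => (coords R0 i)%:P + 'X * (coords R1 i)%:P), r => // s /Hr/f0 <-.
apply: meval_eq => i; rewrite -(channels_ofK w i) hornerD hornerM hornerX !hornerC.
by rewrite /coords; case: (enum_val i) => [[[k j] a] b]; rewrite !mxE.
Qed.

End Sufficiency.

(** * Necessity *)

Section Necessity.
Variables (C : numClosedFieldType) (K M N d : nat).
Notation channels := (channels C K M N).
Notation m := #|{: entry K M N}|.
Implicit Types (H : channels) (W : 'I_K -> 'M[C]_(d, N)) (V : 'I_K -> 'M[C]_(M, d)).

Lemma vanishing_union (I : finType) (P : I -> channels -> Prop) :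
  (forall i, exists2 f : {mpoly C[m]}, f != 0 &
     forall H, P i H -> f.@[coords H] = 0) ->
  exists2 f : {mpoly C[m]}, f != 0 &
     forall i H, P i H -> f.@[coords H] = 0.
Proof.
move=> Pv; have /choice[f Hf] i : exists f : {mpoly C[m]}, f != 0 /\
    forall H, P i H -> f.@[coords H] = 0.
  by have [f] := Pv i; exists f.
exists (\prod_i f i) => [|i H /(proj2 (Hf i)) f0].
  by apply/prodf_neq0 => i _; case: (Hf i).
by rewrite (bigD1 i) //= mevalM f0 mul0r.
Qed.

Section Chart.
Variables (sM : 'I_K -> {ffun 'I_d -> 'I_M}) (sN : 'I_K -> {ffun 'I_d -> 'I_N}).

(** Changing bases on both sides to obtain the identity blocks preserves only the off-diagonal
    equations. *)
Definition chart H W V :=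
  [/\ forall k a b, V k (sM k a) b = (a == b)%:R,
      forall k a b, W k a (sN k b) = (a == b)%:R &
      forall k j, k != j -> W k *m H k j *m V j = 0].

Hypotheses (sM_inj : forall k, injective (sM k)) (sN_inj : forall k, injective (sN k)).
Hypothesis lt_MN : (M + N < d * (K + 1))%N.
Hypotheses (K_gt0 : (0 < K)%N) (d_gt0 : (0 < d)%N).

Let A : Type := entry K M N + (('I_K * 'I_M * 'I_d) + ('I_K * 'I_N * 'I_d)).
Let B : Type := ('I_K * 'I_K * 'I_d * 'I_d) + ('I_K * 'I_d * 'I_d).

(* The coordinates determined by the others: the alignment equations give the
   pivot entries of H k j for k <> j; the unused case k = j indexes the identity
   block of V k. *)
Let g (y : B) : A :=
  match y with
  | inl (k, j, a, b) =>
      if k == j then inr (inl (k, sM k a, b)) else inl (k, j, sN k a, sM j b)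
  | inr (k, a, b) => inr (inr (k, sN k a, b))
  end.

Let g_inj : injective g.
Proof.
move=> [[[[k j] a] b]|[[k a] b]] [[[[k' j'] a'] b']|[[k' a'] b']] //=.
- case: eqP => [<-|_]; case: eqP => [<-|_] //.
    by case=> <- /sM_inj <- <-.
  by case=> <- <- /sN_inj <- /sM_inj <-.
- by case: ifP.
- by case: ifP.
- by case=> <- /sN_inj <- <-.
Qed.

Let T := {x : A | x \notin codom g}.

Let lt_Tm : (#|{: T}| < m)%N.
Proof.
have cT : #|{: T}| = #|[predC codom g]| by rewrite card_sig; apply: eq_card.
have := cardC (mem (codom g)); rewrite card_codom // -cT.
(* There are m + K d (M + N) - K d^2 (K + 1) free coordinates, fewer than [m] by [lt_MN]. *)
rewrite /A /B !card_sum !card_prod !card_ord; nia.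
Qed.

Let val H W V (x : A) : C :=
  match x with
  | inl (k, j, r, c) => H k j r c
  | inr (inl (k, c, b)) => V k c b
  | inr (inr (k, r, a)) => W k a r
  end.

Let free_val H W V (i : 'I_#|{: T}|) : C := val H W V (sval (enum_val i)).

Let polyfun (phi : channels -> ('I_K -> 'M[C]_(d, N)) -> ('I_K -> 'M[C]_(M, d)) -> C) :=
  exists p : {mpoly C[#|{: T}|]},
    forall H W V, chart H W V -> p.@[free_val H W V] = phi H W V.

Let polyfunM phi psi : polyfun phi -> polyfun psi ->
  polyfun (fun H W V => phi H W V * psi H W V).
Proof.
move=> [p Ep] [q Eq]; exists (p * q) => H W V ch.
by rewrite mevalM Ep // Eq.
Qed.

Let polyfun_free x : x \notin codom g -> polyfun (fun H W V => val H W V x).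
Proof.
move=> xg; exists 'X_(enum_rank (exist _ x xg : T)) => H W V _.
by rewrite mevalXU /free_val enum_rankK.
Qed.

Let polyfunV k c b : polyfun (fun H W V => V k c b).
Proof.
have [/codomP[y]|/polyfun_free//] := boolP (inr (inl (k, c, b)) \in codom g).
case: y => [[[[k' j'] a'] b']|[[k' a'] b']] //=; case: ifP => // _ [-> -> ->].
by exists ((a' == b')%:R) => H W V [EV _ _]; rewrite EV rmorph_nat.
Qed.

Let polyfunW k a r : polyfun (fun H W V => W k a r).
Proof.
have [/codomP[y]|/polyfun_free//] := boolP (inr (inr (k, r, a)) \in codom g).
case: y => [[[[k' j'] a'] b']|[[k' a'] b']] //=; first by case: ifP.
case=> -> -> ->.
by exists ((b' == a')%:R) => H W V [_ EW _]; rewrite EW rmorph_nat.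
Qed.

(** If [H k j r c] is a determined entry other than the pivot for (a, b), one of its two factors is
    an off-diagonal zero of an identity block. Hence equation (a, b) involves a single determined
    channel entry. *)
Let polyfunH_term k j a b r c : (r, c) != (sN k a, sM j b) ->
  polyfun (fun H W V => W k a r * H k j r c * V j c b).
Proof.
move=> ne.
have [/codomP[y]|nfree] := boolP (inl (k, j, r, c) \in codom g); last first.
  apply: polyfunM; last exact: polyfunV.
  by apply: polyfunM; [exact: polyfunW | exact: (polyfun_free nfree)].
case: y => [[[[k' j'] a'] b']|[[k' a'] b']] //=; case: ifP => // _ [Ek Ej Er Ec].
move: ne; rewrite Er Ec -Ek -Ej => ne.
exists 0 => H W V [EV EW _]; rewrite meval0 EV EW.
have [E|_] := eqVneq a a'; last by rewrite !mul0r.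
have [E'|_] := eqVneq b' b; last by rewrite mulr0.
by rewrite E E' eqxx in ne.
Qed.

(** In equation (a, b) the pivot entry has coefficient 1 * 1, so it is minus the sum of the other
    terms. *)
Let polyfunH k j r c : polyfun (fun H W V => H k j r c).
Proof.
have [/codomP[y]|nfree] := boolP (inl (k, j, r, c) \in codom g); last first.
  exact: (polyfun_free nfree).
case: y => [[[[k' j'] a] b]|[[k' a'] b']] //=; case: ifP => // ne [Ek Ej -> ->].
rewrite -{}Ek -{}Ej in ne *.
have /choice[q Hq] (x : 'I_N * 'I_M) : exists q : {mpoly C[#|{: T}|]},
    x != (sN k a, sM j b) -> forall H W V, chart H W V ->
      q.@[free_val H W V] = W k a x.1 * H k j x.1 x.2 * V j x.2 b.
  (* The value at the pivot is a placeholder; the sum below omits it. *)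
  have [->|nx] := eqVneq x (sN k a, sM j b); first by exists 0.
  by case: x nx => x1 x2 /polyfunH_term[q Eq]; exists q.
exists (- \sum_(x | x != (sN k a, sM j b)) q x) => H W V ch.
rewrite mevalN rmorph_sum /=.
under eq_bigr => x nx do rewrite (Hq x nx _ _ _ ch).
case: ch => EV EW EZ.
have /matrixP/(_ a b) := EZ k j (negbT ne).
rewrite [RHS]mxE mxE.
under [X in X = 0 -> _]eq_bigr => c' _ do rewrite mxE mulr_suml.
rewrite exchange_big pair_big /= (bigD1 (sN k a, sM j b)) //= EV EW !eqxx.
by rewrite mul1r mulr1 => /eqP; rewrite addr_eq0 => /eqP <-.
Qed.

Lemma chart_vanishing : exists2 f : {mpoly C[m]}, f != 0 &
  forall H, (exists W V, chart H W V) -> f.@[coords H] = 0.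
Proof.
have /choice[phi Hphi] (i : 'I_m) : polyfun (fun H W V => coords H i).
  by rewrite /coords; case: (enum_val i) => [[[k j] r] c]; exact: polyfunH.
have [f fn0 f0] := algebraic_dependence phi lt_Tm.
exists f => // H [W [V ch]]; rewrite -[RHS](f0 (free_val H W V)).
by apply: meval_eq => i; rewrite Hphi.
Qed.

End Chart.

Lemma row_full_normalize p (A : 'M[C]_(p, d)) : row_full A ->
  exists (s : {ffun 'I_d -> 'I_p}) (Q : 'M[C]_d),
    injective s /\ forall a b, (A *m Q) (s a) b = (a == b)%:R.
Proof.
move=> fA; exists (fullrankfun fA), (invmx (rowsub (fullrankfun fA) A)).
split=> [|a b]; first exact: fullrankfun_inj.
have /matrixP/(_ a b) := mulmxV (fullrowsub_unit fA).
by rewrite mul_rowsub_mx [RHS]mxE mxE.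
Qed.

(** The diagonal equations give [V k] a left inverse and [W k] a right inverse, so both have
    invertible [d] by [d] blocks. *)
Lemma aligned_chart H W V : aligned H W V ->
  exists (sM : 'I_K -> {ffun 'I_d -> 'I_M}) (sN : 'I_K -> {ffun 'I_d -> 'I_N}),
    [/\ forall k, injective (sM k), forall k, injective (sN k) &
      exists W' V', chart sM sN H W' V'].
Proof.
move=> al.
have fullV k : row_full (V k).
  by apply/row_fullP; exists (W k *m H k k); rewrite al eqxx.
have fullW k : row_full (W k)^T.
  apply/row_fullP; exists (H k k *m V k)^T.
  by rewrite -trmx_mul mulmxA al eqxx trmx1.
have /choice[sM /choice[Q HQ]] := fun k => row_full_normalize (fullV k).
have /choice[sN /choice[P HP]] := fun k => row_full_normalize (fullW k).
exists sM, sN; split=> [k|k|]; [by case: (HQ k) | by case: (HP k) |].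
exists (fun k => (P k)^T *m W k), (fun k => V k *m Q k); split=> [k a b|k a b|k j ne].
- by case: (HQ k) => _ ->.
- case: (HP k) => _ /(_ b a); rewrite eq_sym => <-.
  by rewrite -[W k]trmxK -trmx_mul mxE trmxK.
- by rewrite !mulmxA -(mulmxA (P k)^T) -(mulmxA _ (W k *m _)) al (negPf ne) mulmx0 mul0mx.
Qed.

Lemma achievable_vanishing :
  (0 < K)%N -> (0 < d)%N -> (M + N < d * (K + 1))%N ->
  exists2 f : {mpoly C[m]}, f != 0 &
    forall H, achievable H (fun _ => d) -> f.@[coords H] = 0.
Proof.
move=> K_gt0 d_gt0 lt_MN.
(* Pivot choices are encoded as finite functions to make the union finite. *)
pose I := ({ffun 'I_K -> {ffun 'I_d -> 'I_M}} * {ffun 'I_K -> {ffun 'I_d -> 'I_N}})%type.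
pose P (i : I) H := [/\ forall k, injective (i.1 k), forall k, injective (i.2 k) &
  exists W V, chart i.1 i.2 H W V].
have [i|f fn0 f0] := @vanishing_union I P.
  have [[inj1 inj2]|ninj] :=
      EM ((forall k, injective (i.1 k)) /\ (forall k, injective (i.2 k))).
    have [f fn0 f0] := chart_vanishing inj1 inj2 lt_MN K_gt0 d_gt0.
    by exists f => // H [_ _ /f0].
  (* Pivots that are not injective give an empty piece. *)
  by exists 1; [exact: oner_neq0 | move=> H [h1 h2 _]; case: ninj].
exists f => // H /achievableP[W [V /aligned_chart[sM [sN [inj1 inj2 [W' [V' ch]]]]]]].
have E1 : [ffun k => sM k] =1 sM by move=> k; rewrite ffunE.
have E2 : [ffun k => sN k] =1 sN by move=> k; rewrite ffunE.
apply: (f0 ([ffun k => sM k], [ffun k => sN k])); split=> /= [k|k|].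
- by rewrite E1.
- by rewrite E2.
- by exists W', V'; case: ch => h1 h2 h3; split=> // k a b; rewrite (E1, E2).
Qed.

End Necessity.

Theorem mainTheorem4 (R : realType) (K M N d : nat)
  (hK : (1 <= K)%N) (hM : (0 < M)%N) (hN : (0 < N)%N) (hd : (0 < d)%N)
  (hdM : (d %| M)%N) (hdN : (d %| N)%N) :
  generically (fun H : channels R[i] K M N => achievable H (fun _ => d)) <->
  (d * (K + 1) <= M + N)%N.
Proof.
split=> [[O [[S OS] [H0 OH0] Oach]]|le_d].
  rewrite leqNgt; apply/negP => lt_MN.
  have [f fn0 f0] := achievable_vanishing R[i] hK hd lt_MN.
  have [p [Sp pH0]] : exists p, S p /\ p.@[coords H0] != 0.
    apply: contrapT => h; apply/OS: OH0 => p Sp.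
    by apply: contrapT => /eqP pn0; apply: h; exists p.
  (* Where [p] and [f] are both nonzero, the channel lies in [O], so it is achievable and [f]
     vanishes there, a contradiction. *)
  have [v] : exists v, (p * f).@[v] != 0.
    apply: mpoly_nonzero_point; rewrite mulf_neq0 //.
    by apply: contraNneq pH0 => ->; rewrite meval0.
  rewrite -(meval_eq _ (channels_ofK v)) mevalM mulf_eq0 negb_or.
  move=> /andP[/eqP pv /eqP]; apply; apply/f0/Oach.
  by apply: contrapT => /OS/(_ p Sp).
apply: generically_dense => f.
have pos a b : (0 < a)%N -> a = (b * d)%N -> exists b', a = (b'.+1 * d)%N.
  by case: b => [|b] a0 E; [rewrite E in a0 | exists b].
have [[p0 /(pos _ _ hM)[p ME]] [q0 /(pos _ _ hN)[q NE]]] := (dvdnP hdM, dvdnP hdN).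
case: K M N hK hM hN {hdM hdN} ME NE le_d f => [|K] [|M] [|N] // _ _ _ ME NE le_d f.
(* Dividing d (K + 2) <= (p + q + 2) d by [d], where the number of users is now [K.+1]. *)
have le_K : (K.+1 <= p + q + 1)%N by rewrite ME NE in le_d; nia.
exact: (achievable_dense hd ME NE le_K).
Qed.
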